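(* Let $H$ be an $n$-vertex graph, and let $G$ be a trigraph obtained by subdividing each edge of $H$ at least $2\lceil \log_2 n\rceil-1$ times and then turning red an arbitrary subset of the edges of the resulting graph, subject to the conditions that every vertex of $G$ has red degree at most $4$ and no vertex of red degree $4$ has a neighbour joined to it by a black edge. Then $tww(G)\leqslant 4$.
   Context: A trigraph $G$ consists of a vertex set $V(G)$ and two disjoint sets of unordered pairs of distinct vertices: black edges $E(G)$ and red edges $R(G)$; a graph is a trigraph with no red edge. The red degree of a vertex is the number of red edges incident to it. Contracting two distinct vertices $u,v$ of a trigraph replaces them by a single new vertex $w$ such that, for every other vertex $z$, $wz$ is a black edge if $uz$ and $vz$ are both black edges, $wz$ is a non-edge if $uz$ and $vz$ are both non-edges, and $wz$ is a red edge otherwise; the rest of the trigraph is unchanged. A contraction sequence from an $n$-vertex trigraph $G$ is a sequence $G=G_n,\dots,G_1$ in which each $G_{j}$ is obtained from $G_{j+1}$ by one contraction. A $d$-sequence is a contraction sequence in which every trigraph has maximum red degree at most $d$. The twin-width $tww(G)$ is the least $d$ such that $G$ admits a $d$-sequence. *)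

(* Defs.v *)
From mathcomp Require Import all_boot.
Set Implicit Arguments. Unset Strict Implicit. Unset Printing Implicit Defensive.

(* A trigraph whose vertex set is a finite subset of an ambient finite type T.
   Black edges and red edges are given by relations (only pairs of distinct
   vertices of [tverts] matter). *)
Record trigraph (T : finType) := Trigraph {
  tverts : {set T};
  tblack : rel T;
  tred : rel T }.

Definition wf_trigraph (T : finType) (G : trigraph T) : Prop :=
  [/\ symmetric (tblack G), symmetric (tred G),
      irreflexive (tblack G), irreflexive (tred G) &
      forall x y, ~~ (tblack G x y && tred G x y)].

(* Contraction of distinct vertices u, v: the new vertex w is named u
   (renaming does not matter since twin-width is an isomorphism invariant);
   v is removed.  For z <> u: wz black iff uz and vz black; wz non-edge iff
   uz and vz both non-edges; wz red otherwise.  Other pairs unchanged. *)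
Definition contract (T : finType) (G : trigraph T) (u v : T) : trigraph T :=
  let B := tblack G in let Rd := tred G in
  let nb z := B u z && B v z in
  let nr z := ~~ (B u z && B v z) && [|| B u z, Rd u z, B v z | Rd v z] in
  Trigraph (tverts G :\ v)
    (fun x y => (x != y) &&
       (if x == u then nb y else if y == u then nb x else B x y))
    (fun x y => (x != y) &&
       (if x == u then nr y else if y == u then nr x else Rd x y)).

Definition red_degree (T : finType) (G : trigraph T) (x : T) : nat :=
  #|[set z in tverts G | (z != x) && tred G x z]|.

Definition max_red_le (T : finType) (G : trigraph T) (d : nat) : Prop :=
  forall x, x \in tverts G -> red_degree G x <= d.

Inductive dseq (T : finType) (d : nat) : trigraph T -> Prop :=
| dseq_end G : #|tverts G| <= 1 -> max_red_le G d -> dseq d G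
| dseq_step G u v : max_red_le G d -> u \in tverts G -> v \in tverts G ->
    u != v -> dseq d (contract G u v) -> dseq d G.

Definition tww_le (T : finType) (G : trigraph T) (d : nat) : Prop :=
  exists d', d' <= d /\ dseq d' G.

(* The graph g on T is obtained from the graph e on V by subdividing every
   edge at least m times: f embeds the branch vertices, p a b is the sequence
   of subdivision vertices on the path replacing edge ab (from a to b). *)
Definition subdivision_of (V T : finType) (e : rel V) (m : nat) (g : rel T)
    (f : V -> T) (p : V -> V -> seq T) : Prop :=
  [/\ injective f,
      forall a b, e a b ->
        [/\ p b a = rev (p a b), uniq (p a b), m <= size (p a b) &
            forall x, x \in p a b -> x \notin codom f],
      forall a b c d, e a b -> e c d ->
        ~~ (((a == c) && (b == d)) || ((a == d) && (b == c))) ->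
        forall x, x \in p a b -> x \notin p c d,
      forall x, x \notin codom f -> exists a b, e a b /\ x \in p a b &
      forall x y, g x y <->
        exists a b, e a b /\ (x, y) \in zip (f a :: p a b) (rcons (p a b) (f b))].

(* Main.v *)
(* Let L = ceil(log2 n) and map the branch vertices to leaves, at depth L, of a
   binary tree. A subdivided edge ab has length at least 2L, so it can be folded
   onto the tree walk from the leaf of a to the root and down to the leaf of b.
   Fold the paths one after the other, each from one end to the other. At any
   time a node of the tree has at most three neighbours in the tree, plus the next
   vertex of the path being folded, hence red degree at most 4. A branch vertex
   trades its neighbours for the single edge to its parent in the tree. When all
   paths are folded, what remains is a part of a binary tree, which is
   contracted by repeatedly merging the last node in breadth-first order into its
   parent. *)
Require Import Defs.
From mathcomp Require Import all_boot.
From mathcomp Require Import zify.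
Set Implicit Arguments. Unset Strict Implicit. Unset Printing Implicit Defensive.

(** * Contraction sequences as successive relabellings of a partition *)

Section Quotient.

Variables (T : finType) (K : eqType) (black red : rel T).
Hypotheses (blackC : symmetric black) (redC : symmetric red).

(* Trigraphs of a contraction sequence are partitions of [T], given by labellings
   [phi] of the vertices; contracting two parts replaces one label by another. *)
Definition all_black (phi : T -> K) (k l : K) : bool :=
  [forall x, forall y, (phi x == k) && (phi y == l) ==> black x y].

Definition some_edge (phi : T -> K) (k l : K) : bool :=
  [exists x, exists y, [&& phi x == k, phi y == l & black x y || red x y]].

Definition red_between phi k l := some_edge phi k l && ~~ all_black phi k l.

Lemma all_blackP phi k l :
  reflect (forall x y, phi x = k -> phi y = l -> black x y) (all_black phi k l).
Proof.
apply: (iffP 'forall_forallP) => [h x y hx hy|h x y].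
  by have := h x y; rewrite hx hy !eqxx.
by apply/implyP=> /andP[/eqP hx /eqP hy]; apply: h.
Qed.

Lemma some_edgeP phi k l :
  reflect (exists x y, [/\ phi x = k, phi y = l & black x y || red x y])
          (some_edge phi k l).
Proof.
apply: (iffP 'exists_existsP) => [[x [y /and3P[/eqP hx /eqP hy h]]]|[x [y [hx hy h]]]].
  by exists x, y.
by exists x, y; rewrite hx hy !eqxx.
Qed.

Lemma all_blackC phi k l : all_black phi k l = all_black phi l k.
Proof. by apply/all_blackP/all_blackP=> h x y hx hy; rewrite blackC h. Qed.

Lemma some_edgeC phi k l : some_edge phi k l = some_edge phi l k.
Proof.
by apply/some_edgeP/some_edgeP=> -[x [y [hx hy h]]]; exists y, x; rewrite blackC redC.
Qed.

Definition relabel (k l : K) (phi : T -> K) x := if phi x == k then l else phi x.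

Lemma all_black_relabel phi k l m n : m != k -> n != k -> m != l -> n != l ->
  all_black (relabel k l phi) m n = all_black phi m n.
Proof.
rewrite /relabel => mk nk ml nl; apply/all_blackP/all_blackP=> h x y hx hy; apply: h.
- by rewrite hx (negPf mk).
- by rewrite hy (negPf nk).
- by case: ifP hx => // _ lm; rewrite lm eqxx in ml.
- by case: ifP hy => // _ lm; rewrite lm eqxx in nl.
Qed.

Lemma some_edge_relabel phi k l m n : m != k -> n != k ->
  some_edge phi m n -> some_edge (relabel k l phi) m n.
Proof.
rewrite /relabel => mk nk /some_edgeP[x [y [hx hy h]]]; apply/some_edgeP.
by exists x, y; rewrite hx hy (negPf mk) (negPf nk).
Qed.

Lemma all_black_merge phi k l n : n != k -> n != l ->
  all_black (relabel k l phi) l n = all_black phi l n && all_black phi k n.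
Proof.
rewrite /relabel => nk nl; apply/all_blackP/andP.
  move=> h; split; apply/all_blackP=> x y hx hy; apply: h; rewrite ?hx ?hy.
  - by case: eqP.
  - by rewrite (negPf nk).
  - by rewrite eqxx.
  - by rewrite (negPf nk).
move=> [/all_blackP h1 /all_blackP h2] x y hx hy.
have {}hy : phi y = n by case: ifP hy => // _ ln; rewrite ln eqxx in nl.
by case: eqP hx => [hx _|_ hx]; [apply: h2 | apply: h1].
Qed.

Lemma some_edge_merge phi k l n : n != k ->
  some_edge phi l n || some_edge phi k n -> some_edge (relabel k l phi) l n.
Proof.
rewrite /relabel => nk /orP[] /some_edgeP[x [y [hx hy h]]]; apply/some_edgeP;
  exists x, y; rewrite hx hy (negPf nk); split=> //.
- by case: ifP.
- by rewrite eqxx.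
Qed.

(* [G] is the quotient of the trigraph [(black, red)] by the kernel of [phi], except
   that its red edges are only bounded from above. *)
Definition represents (phi : T -> K) (G : trigraph T) : Prop :=
  [/\ {in tverts G &, injective phi},
      forall x, exists2 s, s \in tverts G & phi s = phi x &
      {in tverts G &, forall s t, s != t ->
        tblack G s t = all_black phi (phi s) (phi t) /\
        (tred G s t -> red_between phi (phi s) (phi t))}].

(** Merging turns blackness into a conjunction, exactly as in [contract]. For red edges an inclusion
    suffices: an edge at either old part survives in the merged part. *)
Lemma represents_contract phi G u v : u \in tverts G -> v \in tverts G -> u != v ->
  represents phi G -> represents (relabel (phi v) (phi u) phi) (contract G u v).
Proof.
move=> uG vG uv [inj surj bnd].
have phi_neq s t : s \in tverts G -> t \in tverts G -> s != t -> phi s != phi t.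
  by move=> sG tG; apply: contra => /eqP /inj -> //.
have E s : s \in tverts G -> s != v -> relabel (phi v) (phi u) phi s = phi s.
  by move=> sG sv; rewrite /relabel (negPf (phi_neq _ _ sG vG sv)).
have merge z : z \in tverts G -> z != u -> z != v ->
  let nb := tblack G u z && tblack G v z in
  nb = all_black (relabel (phi v) (phi u) phi) (phi u) (phi z) /\
  (~~ nb && [|| tblack G u z, tred G u z, tblack G v z | tred G v z] ->
   red_between (relabel (phi v) (phi u) phi) (phi u) (phi z)).
  move=> zG zu zv /=.
  have zv' := phi_neq _ _ zG vG zv; have zu' := phi_neq _ _ zG uG zu.
  have [uz vz] : u != z /\ v != z by rewrite !(eq_sym _ z).
  have [b1 r1] := bnd u z uG zG uz; have [b2 r2] := bnd v z vG zG vz.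
  rewrite /red_between all_black_merge // b1 b2; split=> // /andP[nb h].
  rewrite nb andbT; apply: some_edge_merge => //.
  (* Parts are nonempty, so a completely black pair of parts also contains an edge. *)
  have be w : all_black phi (phi w) (phi z) -> some_edge phi (phi w) (phi z).
    by move/all_blackP=> a; apply/some_edgeP; exists w, z; rewrite a.
  case/or4P: h => [/be->|/r1/andP[-> _]|/be->|/r2/andP[-> _]] //; exact: orbT.
split.
- by move=> s t /setD1P[sv sG] /setD1P[tv tG]; rewrite !E //; apply: inj.
- move=> x; case: (eqVneq (phi x) (phi v)) => [xv|xv].
    by exists u; rewrite ?inE ?uv // E // /relabel xv eqxx.
  have [s sG sx] := surj x; exists s; last by rewrite /relabel sx.
  by rewrite !inE sG andbT; apply: contra xv => /eqP <-; rewrite sx.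
move=> s t /setD1P[sv sG] /setD1P[tv tG] st; rewrite !E //= st /=.
case: (eqVneq s u) st => [-> |su] st; first by apply: merge => //; rewrite eq_sym.
case: (eqVneq t u) st => [-> |tu] st.
  have [m1 m2] := merge s sG su sv; split; first by rewrite all_blackC.
  by move/m2; rewrite /red_between some_edgeC all_blackC.
rewrite /red_between all_black_relabel ?phi_neq //.
have [-> r] := bnd s t sG tG st; split=> // /r /andP[h ->]; rewrite andbT.
by apply: some_edge_relabel; rewrite ?phi_neq.
Qed.

(** A list of candidate labels replaces a cardinality: [K] need not be finite, and the candidates
    may include labels that do not occur. *)
Definition red_bounded (d : nat) (phi : T -> K) : Prop :=
  forall x, exists2 r : seq K, size r <= d &
    forall y, phi y != phi x -> red_between phi (phi x) (phi y) -> phi y \in r.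

Lemma represents_max_red d phi G :
  represents phi G -> red_bounded d phi -> max_red_le G d.
Proof.
move=> [inj _ bnd] bd x xG; have [r rd hr] := bd x.
rewrite /red_degree; set A := [set _ | _].
rewrite cardE -(size_map phi); apply: leq_trans rd; apply: uniq_leq_size.
  rewrite map_inj_in_uniq ?enum_uniq // => y z.
  by rewrite !mem_enum !inE => /andP[yG _] /andP[zG _]; apply: inj.
move=> l /mapP[y]; rewrite mem_enum inE => /and3P[yG yx xy] ->.
apply: hr; first by apply: contra yx => /eqP /inj ->.
have xy' : x != y by rewrite eq_sym.
by have [_] := bnd x y xG yG xy'; apply.
Qed.

(** Quantifying over every representing trigraph avoids tracking which vertex names a part and which
    of the permitted red edges are present. *)
Definition quotient_dseq (d : nat) (phi : T -> K) : Prop :=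
  forall G, represents phi G -> dseq d G.

Lemma quotient_dseq_const d phi : red_bounded d phi ->
  (forall x y, phi x = phi y) -> quotient_dseq d phi.
Proof.
move=> bd cst G rep; apply: dseq_end; last exact: represents_max_red bd.
have [inj _ _] := rep; apply/card_le1_eqP=> x y xG yG; exact: inj.
Qed.

Lemma eq_all_black phi psi : phi =1 psi -> all_black phi =2 all_black psi.
Proof.
move=> E k l; apply/all_blackP/all_blackP=> h x y; have := h x y; rewrite !E; exact.
Qed.

Lemma eq_some_edge phi psi : phi =1 psi -> some_edge phi =2 some_edge psi.
Proof.
by move=> E k l; apply/some_edgeP/some_edgeP=> -[x [y [? ? ?]]]; exists x, y;
   rewrite ?E // -?E.
Qed.

Lemma eq_represents phi psi G : phi =1 psi -> represents phi G -> represents psi G.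
Proof.
move=> E [inj surj bnd]; split.
- by move=> x y xG yG; rewrite -!E; apply: inj.
- by move=> x; have [s sG sx] := surj x; exists s; rewrite -?E.
move=> s t sG tG st; have := bnd s t sG tG st.
by rewrite /red_between -!E !(eq_all_black E) !(eq_some_edge E).
Qed.

Lemma relabel_fresh phi k l G : (forall x, phi x != l) ->
  represents phi G -> represents (relabel k l phi) G.
Proof.
move=> fresh [inj surj bnd].
have relabelE x y : (relabel k l phi x == relabel k l phi y) = (phi x == phi y).
  rewrite /relabel; case: (eqVneq (phi x) k) => [xk|xk].
    rewrite (eq_sym (phi x)); case: (eqVneq (phi y) k) => [yk|yk]; first by rewrite xk yk !eqxx.
    by rewrite xk (negPf yk) eq_sym (negPf (fresh y)).
  case: (eqVneq (phi y) k) => [yk|yk] //.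
  by rewrite (negPf (fresh x)) yk (negPf xk).
have AB s t : all_black (relabel k l phi) (relabel k l phi s) (relabel k l phi t)
     = all_black phi (phi s) (phi t).
  by apply: eq_forallb => x; apply: eq_forallb => y; rewrite !relabelE.
have SE s t : some_edge (relabel k l phi) (relabel k l phi s) (relabel k l phi t)
     = some_edge phi (phi s) (phi t).
  by apply: eq_existsb => x; apply: eq_existsb => y; rewrite !relabelE.
split.
- by move=> x y xG yG /eqP; rewrite relabelE => /eqP; apply: inj.
- by move=> x; have [s sG /eqP sx] := surj x; exists s => //; apply/eqP; rewrite relabelE.
by move=> s t sG tG st; rewrite /red_between AB SE; apply: bnd.
Qed.

(** If [k] or [l] does not occur, or if they coincide, the partition does not change; otherwise this
    is one contraction. Later moves can thus target a tree node without knowing whether it is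
    occupied. *)
Lemma quotient_dseq_step d phi k l : red_bounded d phi ->
  quotient_dseq d (relabel k l phi) -> quotient_dseq d phi.
Proof.
move=> bd IH G rep.
case: (pickP (fun x => phi x == l)) => [x /eqP xl|fresh]; last first.
  by apply: IH; apply: relabel_fresh => // x; rewrite fresh.
case: (pickP (fun x => phi x == k)) => [y /eqP yk|nok]; last first.
  by apply: IH; apply: eq_represents rep => z; rewrite /relabel nok.
case: (eqVneq k l) => [kl|kl].
  by apply: IH; apply: eq_represents rep => z; rewrite /relabel kl; case: eqP.
have [_ surj _] := rep.
have [u uG ux] := surj x; have [v vG vy] := surj y.
have uv : u != v by apply: contra kl => /eqP uv; rewrite -yk -vy -uv ux xl.
apply: (dseq_step (represents_max_red rep bd) uG vG uv); apply: IH.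
by rewrite -yk -xl -ux -vy; apply: represents_contract.
Qed.

Lemma represents_injective phi : injective phi ->
  (forall x y, ~~ (black x y && red x y)) ->
  represents phi (Trigraph [set: T] black red).
Proof.
move=> inj disj; split=> [x y _ _|x|s t _ _ st] /=; [exact: inj | by exists x; rewrite ?inE |].
have AB : all_black phi (phi s) (phi t) = black s t.
  by apply/all_blackP/idP=> [|h x y /inj-> /inj->] //; apply.
split=> // rst; rewrite /red_between AB; apply/andP; split.
  by apply/some_edgeP; exists s, t; rewrite rst orbT.
by have := disj s t; rewrite rst andbT.
Qed.

End Quotient.

(** * Steps in the binary tree and positions along a walk *)

(* Heap numbering of the infinite binary tree: root [1], [h] has parent [h./2]. *)
Definition heap_near (h k : nat) := [|| h == k, h == k./2 | k == h./2].

Lemma heap_nearC : symmetric heap_near.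
Proof. by move=> h k; rewrite /heap_near (eq_sym h k) [(h == _) || _]orbC. Qed.

Lemma heap_near_max1 h : heap_near (maxn 1 h) (maxn 1 h./2).
Proof. rewrite /heap_near; lia. Qed.

Lemma divn_expSr x j : x %/ 2 ^ j.+1 = (x %/ 2 ^ j)./2.
Proof. by rewrite expnSr divnMA divn2. Qed.

(** The length bound forces [L <= j] or [L <= k], so on one side both ancestors are at most the root
    and are absorbed by [maxn 1]; the other side moves by one parent step. *)
Lemma heap_near_ancestors L x y j k :
  x < 2 ^ L.+1 -> y < 2 ^ L.+1 -> 2 * L <= (j + k).+1 ->
  heap_near (maxn 1 (maxn (x %/ 2 ^ j) (y %/ 2 ^ k.+1)))
            (maxn 1 (maxn (x %/ 2 ^ j.+1) (y %/ 2 ^ k))).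
Proof.
wlog Lj : x y j k / L <= j => [wl|] xL yL jk.
  case: (leqP L j) => Lj; first exact: wl.
  by rewrite heap_nearC ![maxn _ (y %/ _)]maxnC; apply: wl => //; lia.
have x1 : x %/ 2 ^ j <= 1.
  rewrite -ltnS ltn_divLR ?expn_gt0 // (leq_trans xL) //.
  by rewrite -expnS leq_exp2l.
rewrite !divn_expSr.
have E a b : a <= 1 -> maxn 1 (maxn a b) = maxn 1 b by lia.
rewrite !E //; last by move: x1; lia.
by rewrite heap_nearC heap_near_max1.
Qed.

Lemma mem_zip_walk (T : eqType) (s : seq T) a b x y :
  (x, y) \in zip (a :: s) (rcons s b) <->
  exists2 j, j <= size s &
    x = nth a (a :: rcons s b) j /\ y = nth a (a :: rcons s b) j.+1.
Proof.
have sz : size (a :: s) = size (rcons s b) by rewrite size_rcons.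
have E j : j <= size s -> nth (a, a) (zip (a :: s) (rcons s b)) j =
   (nth a (a :: rcons s b) j, nth a (a :: rcons s b) j.+1).
  by move=> js; rewrite nth_zip //; congr pair; rewrite -rcons_cons nth_rcons ltnS js.
have szz : size (zip (a :: s) (rcons s b)) = (size s).+1.
  by rewrite size_zip -sz minnn.
split.
  case/(nthP (a, a)) => j; rewrite szz ltnS => js; rewrite E // => -[<- <-].
  by exists j.
by case=> j js [-> ->]; rewrite -E // mem_nth // szz ltnS.
Qed.

Lemma index_rev_uniq (T : eqType) (s : seq T) x : uniq s -> x \in s ->
  index x (rev s) = size s - (index x s).+1.
Proof.
move=> us xs; have ix : index x s < size s by rewrite index_mem.
have x_nth : x = nth x (rev s) (size s - (index x s).+1).
  by rewrite nth_rev; [rewrite subnSK // subKn ?nth_index // ltnW | lia].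
by rewrite {1}x_nth index_uniq ?rev_uniq // size_rev; lia.
Qed.

(** * Folding the subdivided graph onto a binary tree of depth [L] *)

Section Fold.

Variables (V T : finType) (e : rel V) (g : rel T) (f : V -> T) (p : V -> V -> seq T).
Variable L : nat.
Hypotheses (eC : symmetric e).
Hypotheses (Lgt0 : 0 < L) (cardV : #|V| <= 2 ^ L).
Hypothesis sub : subdivision_of e (2 * L - 1) g f p.

Lemma branch_inj : injective f. Proof. by case: sub. Qed.

Lemma path_rev a b : e a b -> p b a = rev (p a b).
Proof. by case: sub => _ h _ _ _ /h[]. Qed.

Lemma path_uniq a b : e a b -> uniq (p a b).
Proof. by case: sub => _ h _ _ _ /h[]. Qed.

Lemma path_size a b : e a b -> 2 * L <= (size (p a b)).+1.
Proof. case: sub => _ h _ _ _ /h[_ _ m _]; lia. Qed.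

Lemma path_nonbranch a b x : e a b -> x \in p a b -> x \notin codom f.
Proof. by case: sub => _ h _ _ _ /h[_ _ _]; apply. Qed.

Lemma path_endpoints a b c d x : e a b -> e c d -> x \in p a b -> x \in p c d ->
  (c = a /\ d = b) \/ (c = b /\ d = a).
Proof.
case: sub => _ _ h _ _ ab cd xab xcd.
have := h a b c d ab cd; case: orP => [[]/andP[/eqP-> /eqP->] _|_ /(_ isT x xab)].
- by left.
- by right.
by rewrite xcd.
Qed.

Definition walk a b := f a :: rcons (p a b) (f b).

Lemma adj_walk x y : g x y -> exists a b j, [/\ e a b, j <= size (p a b),
  x = nth (f a) (walk a b) j & y = nth (f a) (walk a b) j.+1].
Proof.
case: sub => _ _ _ _ h /h[a [b [ab /mem_zip_walk[j js [xE yE]]]]].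
by exists a, b, j.
Qed.

(** In heap numbering, depth [L] consists of the numbers from [2 ^ L] to [2 ^ L.+1 - 1]. *)
Definition leaf (a : V) : nat := 2 ^ L + enum_rank a.

Lemma leaf_ge a : 2 ^ L <= leaf a. Proof. exact: leq_addr. Qed.

Lemma leaf_lt a : leaf a < 2 ^ L.+1.
Proof.
by rewrite expnS mul2n -addnn ltn_add2l; apply: leq_trans cardV; apply: ltn_ord.
Qed.

Lemma leaf_inj : injective leaf.
Proof. by move=> a b /addnI /val_inj /enum_rank_inj. Qed.

(* The j-th vertex of the walk from [f a] to [f b] is sent to the j-th ancestor
   of the leaf of [a], or to the corresponding ancestor of the leaf of [b];
   since walks have length at least [2 * L], one of these two is at most [1], so
   that the maximum selects the meaningful one and never goes above the root. *)
Definition fold (x : T) : nat :=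
  if [pick a | f a == x] is Some a then leaf a
  else maxn 1 (\max_(ab : V * V | e ab.1 ab.2 && (x \in p ab.1 ab.2))
                 leaf ab.1 %/ 2 ^ (index x (p ab.1 ab.2)).+1).

Lemma fold_branch a : fold (f a) = leaf a.
Proof.
rewrite /fold; case: pickP => [b /eqP /branch_inj -> //|/(_ a)].
by rewrite eqxx.
Qed.

Lemma index_path_rev a b x : e a b -> x \in p a b ->
  index x (p b a) = size (p a b) - (index x (p a b)).+1.
Proof. by move=> ab; rewrite (path_rev ab); apply: index_rev_uniq; apply: path_uniq. Qed.

(** Only the two orientations of the path through [x] contribute to the maximum in [fold], and
    reversing the path reverses the index. *)
Lemma fold_path a b x : e a b -> x \in p a b ->
  fold x = maxn 1 (maxn (leaf a %/ 2 ^ (index x (p a b)).+1)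
                        (leaf b %/ 2 ^ (size (p a b) - index x (p a b)))).
Proof.
move=> ab xab; have ix : index x (p a b) < size (p a b) by rewrite index_mem.
have ba : e b a by rewrite eC.
have xba : x \in p b a by rewrite (path_rev ab) mem_rev.
have iba : (index x (p b a)).+1 = size (p a b) - index x (p a b).
  by rewrite (index_path_rev ab) // ; lia.
rewrite /fold; case: pickP => [c /eqP fc|_].
  by have := path_nonbranch ab xab; rewrite -fc codom_f.
congr maxn; apply/eqP; rewrite eqn_leq geq_max; apply/and3P; split.
- apply/bigmax_leqP=> -[c d] /= /andP[cd xcd].
  case: (path_endpoints ab cd xab xcd) => -[-> ->]; first exact: leq_maxl.
  by rewrite iba leq_maxr.
- by apply: (leq_bigmax_cond (a, b)); rewrite /= ab xab.
- by rewrite -iba; apply: (leq_bigmax_cond (b, a)); rewrite /= ba xba.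
Qed.

Lemma leaf_divn a j : L <= j -> leaf a %/ 2 ^ j <= 1.
Proof.
move=> Lj; rewrite -ltnS ltn_divLR ?expn_gt0 // (leq_trans (leaf_lt a)) //.
by rewrite -expnS leq_exp2l.
Qed.

(** The formula for interior vertices also covers both ends: the walk has length at least [L], so
    the opposite leaf contributes at most [1] there. *)
Lemma fold_walk a b j : e a b -> j <= (size (p a b)).+1 ->
  fold (nth (f a) (walk a b) j) =
  maxn 1 (maxn (leaf a %/ 2 ^ j) (leaf b %/ 2 ^ ((size (p a b)).+1 - j))).
Proof.
move=> ab; have sz := path_size ab; have L2 : L <= (size (p a b)).+1 by lia.
have pos c : 0 < leaf c by apply: leq_trans (leaf_ge c); rewrite expn_gt0.
case: j => [|j] /= js.
  rewrite fold_branch expn0 divn1 subn0; have := leaf_divn b L2; have := pos a; lia.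
rewrite nth_rcons; case: ltnP => js'.
  rewrite (@fold_path a b) ?mem_nth // index_uniq ?path_uniq //.
have -> : j = size (p a b) by lia.
rewrite eqxx fold_branch subnn expn0 divn1.
have := leaf_divn a L2; have := pos b; lia.
Qed.

Lemma fold_adj x y : g x y -> heap_near (fold x) (fold y).
Proof.
move=> /adj_walk[a [b [j [ab js -> ->]]]].
rewrite !fold_walk //; last by lia.
have := path_size ab; move: js; set m := size _ => js Lm.
have -> : m.+1 - j = (m - j).+1 by lia.
rewrite subSS; apply: (heap_near_ancestors (L := L)); rewrite ?leaf_lt //; lia.
Qed.

Lemma fold_ge1 x : 0 < fold x.
Proof.
rewrite /fold; case: pickP => [a _|_]; last by lia.
by apply: leq_trans (leaf_ge a); rewrite expn_gt0.
Qed.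

Lemma nonbranch_path x : x \notin codom f -> exists a b, e a b /\ x \in p a b.
Proof. by case: sub => _ _ _ h _ /h. Qed.

Lemma leaf_div_lt a j : 0 < j -> leaf a %/ 2 ^ j < 2 ^ L.
Proof.
move=> j0; rewrite ltn_divLR ?expn_gt0 // (leq_trans (leaf_lt a)) //.
by rewrite -expnD leq_exp2l //; lia.
Qed.

Lemma fold_nonbranch x : x \notin codom f -> fold x < 2 ^ L.
Proof.
move=> /nonbranch_path[a [b [ab xab]]]; rewrite (fold_path ab xab) !gtn_max.
by rewrite -{1}(expn0 2) ltn_exp2l // Lgt0 !leaf_div_lt // subn_gt0 index_mem.
Qed.

Lemma fold_lt x : fold x < 2 ^ L.+1.
Proof.
case: (boolP (x \in codom f)) => [/codomP[a ->]|/fold_nonbranch xL].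
  by rewrite fold_branch leaf_lt.
by apply: leq_trans xL _; rewrite leq_exp2l.
Qed.

(** Children of a leaf would have depth [L.+1], out of the range of [fold], and distinct leaves are
    not near each other; only the parent is left. *)
Lemma branch_adj a x : g (f a) x -> f a != x ->
  x \notin codom f /\ fold x = (leaf a)./2.
Proof.
move=> gax ax; have := fold_adj gax; rewrite fold_branch /heap_near.
have := leaf_ge a; have := leaf_lt a; rewrite expnS.
case: (boolP (x \in codom f)) => [/codomP[b xb]|xf].
  move: ax; rewrite xb fold_branch => ab; have := leaf_ge b; have := leaf_lt b; rewrite expnS.
  have lab : leaf a != leaf b by apply: contra ab => /eqP/leaf_inj ->.
  lia.
have := fold_nonbranch xf; split=> //; lia.
Qed.

Lemma nonbranch_degree x : x \notin codom f ->
  exists2 r : seq T, size r <= 2 & forall y, g x y -> y \in r.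
Proof.
move=> xf; have [a [b [ab xab]]] := nonbranch_path xf.
have ba : e b a by rewrite eC.
pose Z c d := zip (f c :: p c d) (rcons (p c d) (f d)).
(* [r c d] lists the successors of [x] on the walk from [c] to [d]; one orientation gives the next
   vertex, the other the previous one. *)
pose r c d := [seq z.2 | z <- Z c d & z.1 == x].
have szr c d : e c d -> size (r c d) <= 1.
  move=> cd; rewrite size_map size_filter -(count_map fst (pred1 x)).
  have -> : [seq z.1 | z <- Z c d] = f c :: p c d by apply: unzip1_zip; rewrite size_rcons.
  rewrite count_uniq_mem ?leq_b1 //= path_uniq // andbT.
  by apply: contraL (codom_f f c) => /path_nonbranch; apply.
exists (r a b ++ r b a); first by rewrite size_cat (leq_add (szr _ _ ab) (szr _ _ ba)).
move=> y xy; case: sub => _ _ _ _ /(_ x y)[/(_ xy)[c [d [cd xyz]]] _].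
have yr : y \in r c d by apply/mapP; exists (x, y); rewrite ?mem_filter /= ?eqxx.
have xcd : x \in p c d.
  have : x \in unzip1 (Z c d) by apply/mapP; exists (x, y).
  rewrite unzip1_zip ?size_rcons // inE => /predU1P[xc|//].
  by rewrite xc codom_f in xf.
by rewrite mem_cat; case: (path_endpoints ab cd xab xcd) yr => -[-> ->] ->; rewrite ?orbT.
Qed.

Lemma nonbranch_adj x y : g x y -> x \notin codom f -> y \notin codom f ->
  exists a b, [/\ e a b, x \in p a b & y \in p a b].
Proof.
move=> /adj_walk[a [b [[|j] [ab js -> ->]]]] /=; first by rewrite codom_f.
rewrite !nth_rcons js; case: ltnP => [js' _ _|_ _].
  by exists a, b; rewrite !mem_nth.
by case: ifP => _; rewrite codom_f.
Qed.

(** Indices of adjacent path vertices differ by one, so an edge leaving the prefix [s1] can only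
    reach the vertex right after it. *)
Lemma path_frontier a b s1 s s2 x y : e a b -> p a b = s1 ++ s :: s2 ->
  x \in s1 -> y \in s :: s2 -> g x y -> y = s.
Proof.
move=> ab pE xs1 ys2 /adj_walk[c [d [j [cd js xE yE]]]].
have xab : x \in p a b by rewrite pE mem_cat xs1.
have yab : y \in p a b by rewrite pE mem_cat ys2 orbT.
have xnb := path_nonbranch ab xab; have ynb := path_nonbranch ab yab.
have ui := path_uniq ab.
have ix : index x (p a b) < size s1 by rewrite pE index_cat xs1 index_mem.
have iy : size s1 <= index y (p a b).
  have : y \notin s1.
    by move: ui; rewrite pE cat_uniq => /and3P[_ /hasPn /(_ y ys2)].
  by rewrite pE index_cat => /negPf ->; rewrite leq_addr.
case: j => [|j] in js xE yE; first by rewrite xE /= codom_f in xnb.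
move: xE yE; rewrite /= nth_rcons js nth_rcons.
case: ltnP => [js' xE yE|_ _]; last first.
  by case: eqP => _ yE; rewrite yE codom_f in ynb.
have xcd : x \in p c d by rewrite xE mem_nth.
have xj : index x (p c d) = j by rewrite xE index_uniq ?path_uniq.
have yj : index y (p c d) = j.+1 by rewrite yE index_uniq ?path_uniq.
have [[ca db]|[ca db]] := path_endpoints ab cd xab xcd.
  have ys : index y (p a b) = size s1 by move: xj yj ix iy; rewrite ca db; clear; lia.
  by rewrite -(nth_index s yab) ys pE nth_cat ltnn subnn.
(* Traversed backwards, the edge would give [y] a smaller index than [x], although [x] lies in the
   prefix and [y] beyond it. *)
move: xj yj; rewrite ca db !(index_path_rev ab) //.
have := ix; have := iy; have : index y (p a b) < size (p a b) by rewrite index_mem.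
clear; lia.
Qed.

End Fold.

(** * Contracting a quotient that maps to a binary tree *)

Section Collapse.

Variables (T : finType) (K : eqType) (black red : rel T).
Hypotheses (blackC : symmetric black) (redC : symmetric red).

Lemma eq_quotient_dseq d (phi psi : T -> K) : phi =1 psi ->
  quotient_dseq black red d phi -> quotient_dseq black red d psi.
Proof.
by move=> E q G rep; apply: q; apply: eq_represents rep => x; rewrite E.
Qed.

(** The largest node has no child in use, so it is near only itself and its parent; replacing it by
    its parent preserves nearness and lowers [N]. *)
Lemma quotient_dseq_heap (lab : nat -> K) N (psi : T -> nat) :
  injective lab ->
  (forall x, 0 < psi x) -> (forall x, psi x <= N) ->
  (forall x y, black x y || red x y -> heap_near (psi x) (psi y)) ->
  quotient_dseq black red 4 (lab \o psi).
Proof.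
move=> lab_inj; elim: N psi => [|N IH] psi pos bd near.
  by move=> G rep; case: (rep) => _ /(_ _) surj _; apply: (quotient_dseq_const _ _ rep) => x;
    have := pos x; have := bd x; lia.
have rb : red_bounded black red 4 (lab \o psi).
  (* The candidates are the parent and the two children. *)
  move=> x; exists [:: lab (psi x)./2; lab (psi x).*2; lab (psi x).*2.+1] => // y xy.
  move=> /andP[/some_edgeP[x' [y' [/lab_inj xE /lab_inj yE /near nr]]] _].
  have {xy} : psi y != psi x by apply: contra xy => /eqP /= ->.
  move: nr; rewrite xE yE /= !inE !(inj_eq lab_inj) /heap_near; lia.
case: N => [|N] in IH bd *.
  by apply: quotient_dseq_const => // x y /=; have := pos x; have := pos y;
    have := bd x; have := bd y => ? ? ? ?; congr lab; lia.
apply: (quotient_dseq_step blackC redC (k := lab N.+2) (l := lab N.+2./2)) => //.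
pose psi' x := if psi x == N.+2 then N.+2./2 else psi x.
apply: (@eq_quotient_dseq _ (lab \o psi')).
  by move=> x; rewrite /relabel /= (inj_eq lab_inj) /psi'; case: eqP.
apply: IH => [x|x|x y /near]; rewrite /psi'.
- by have := pos x; case: eqP; lia.
- by have := bd x; case: eqP; lia.
rewrite /heap_near; have := bd x; have := bd y; have := pos x; have := pos y.
by case: (eqVneq (psi x) N.+2) => [->|?]; case: (eqVneq (psi y) N.+2) => [->|?]; lia.
Qed.

End Collapse.

(** * Folding the paths one vertex at a time *)

Section Sequence.

Variables (V T : finType) (e : rel V) (f : V -> T) (p : V -> V -> seq T).
Variables (black red : rel T) (L : nat).
Let g : rel T := fun x y => black x y || red x y.
Hypotheses (eC : symmetric e) (blackC : symmetric black) (redC : symmetric red).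
Hypotheses (Lgt0 : 0 < L) (cardV : #|V| <= 2 ^ L).
Hypothesis sub : subdivision_of e (2 * L - 1) g f p.
Let G := Trigraph [set: T] black red.
Hypothesis deg4 : forall x, red_degree G x <= 4.
Hypothesis deg4_no_black : forall x y, red_degree G x = 4 -> ~~ black x y.


Let height := fold e f p L.

(* The partition reached once the vertices of [D] have been folded: [inl h] is
   the part of node [h] of the tree, [inr x] the singleton of an untouched [x]. *)
Definition phase (D : {set T}) (x : T) : nat + T :=
  if x \in D then inl (height x) else inr x.

Lemma phase_inr D x y : phase D x = inr y -> x = y /\ x \notin D.
Proof. by rewrite /phase; case: ifP => // _ [->]. Qed.

Lemma phase_inl D x h : phase D x = inl h -> height x = h /\ x \in D.
Proof. by rewrite /phase; case: ifP => // _ [->]. Qed.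

(** Hence the part of a branch vertex remains a singleton throughout the folding. *)
Lemma height_leaf x a : height x = leaf L a -> x = f a.
Proof.
case: (boolP (x \in codom f)) => [/codomP[b ->]|xf].
  by rewrite /height (fold_branch sub) => /leaf_inj ->.
by have := fold_nonbranch eC Lgt0 cardV sub xf; have := leaf_ge L a; rewrite /height; lia.
Qed.

(* Once a neighbour of a branch vertex has been folded, its only folded neighbour
   is its parent in the tree. This edge may become red, which is harmless: either
   the red degree was at most 3, or it was 4 and the folded edge was red. *)
Lemma red_bounded_branch (D : {set T}) a : f a \in D ->
  exists2 r : seq (nat + T), size r <= 4 &
    forall y, phase D y != phase D (f a) ->
      red_between black red (phase D) (phase D (f a)) (phase D y) -> phase D y \in r.
Proof.
move=> aD; have Ea : phase D (f a) = inl (leaf L a).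
  by rewrite /phase aD /height (fold_branch sub).
pose N := [set z in [set: T] | (z != f a) && red (f a) z].
have N4 : #|N| <= 4 := deg4 (f a).
have key y : phase D y != phase D (f a) ->
  red_between black red (phase D) (phase D (f a)) (phase D y) ->
  exists2 z, g (f a) z && (z != f a) &
    if z \in D then phase D y = inl (leaf L a)./2 else phase D y = inr z /\ z \in N.
  move=> ya /andP[/some_edgeP[x' [z [xE zE gxz]]] nb].
  move: xE; rewrite Ea => /phase_inl[/height_leaf x'E _]; rewrite {}x'E in gxz.
  have za : z != f a by apply: contra ya => /eqP <-; rewrite zE.
  exists z; first by rewrite /g gxz.
  have az : f a != z by rewrite eq_sym.
  have [_ hz] := branch_adj eC Lgt0 cardV sub gxz az.
  rewrite -zE /phase; case: ifP => zD; first by rewrite zD -hz.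
  (* Both parts are singletons here, so an edge that is not red makes the pair completely black. *)
  rewrite zD; split=> //; rewrite !inE za /=; apply: contraNT nb => nred.
  apply/all_blackP=> u w; rewrite Ea -zE => /phase_inl[/height_leaf -> _].
  by rewrite {2}/phase zD => /phase_inr[-> _]; rewrite (negPf nred) orbF in gxz.
case: (boolP [exists z in D, g (f a) z && (z != f a)]) => [|none].
  move=> /exists_inP[z zD /andP[gz za]].
  exists (inl (leaf L a)./2 :: [seq inr y | y <- enum (N :\: D)]).
    rewrite /= size_map -cardE ltnS.
    case: (ltnP #|N| 4) => N3.
      by apply: leq_trans (subset_leq_card (subsetDl N D)) _.
    have deg : red_degree G (f a) = 4 by apply/eqP; rewrite eqn_leq deg4.
    have zN : z \in N.
      by move: gz; rewrite !inE za /g (negPf (deg4_no_black z deg)).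
    rewrite -ltnS; apply: leq_trans N4; apply: proper_card.
    by apply/properP; split; [exact: subsetDl | exists z; rewrite // inE zD].
  move=> y ya /(key y ya)[w _]; case: ifP => [_ ->|wD [-> wN]]; rewrite in_cons ?eqxx //.
  by rewrite mem_map ?mem_enum ?in_setD ?wD ?wN ?orbT // => ? ? [].
exists [seq inr y | y <- enum N]; first by rewrite size_map -cardE.
move=> y ya /(key y ya)[w gw]; case: ifP => [wD|_ [-> wN]].
  by case/exists_inP: none; exists w.
by rewrite mem_map ?mem_enum // => ? ? [].
Qed.

(** An untouched vertex has at most two neighbours. An inner node of the tree sees its parent, its
    two children and at most one unfolded vertex, [s0]. *)
Lemma phase_red_bounded (D : {set T}) s0 : {subset codom f <= D} ->
  (forall x y, x \in D -> x \notin codom f -> y \notin D -> g x y -> y = s0) ->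
  red_bounded black red 4 (phase D).
Proof.
move=> fD front x; case: (boolP (x \in D)) => xD; last first.
  have xf : x \notin codom f by apply: contra xD => /fD.
  have [r r2 hr] := nonbranch_degree eC sub xf.
  exists (map (phase D) r); first by rewrite size_map (leq_trans r2).
  move=> y _ /andP[/some_edgeP[x' [y' [xE <- gxy]]] _].
  by move: xE; rewrite {2}/phase (negPf xD) => /phase_inr[xE _]; rewrite map_f ?hr // -xE.
case: (boolP (x \in codom f)) => [/codomP[a xa]|xf].
  by rewrite xa; apply: red_bounded_branch; rewrite -xa.
have Ex : phase D x = inl (height x) by rewrite /phase xD.
exists [:: inl (height x)./2; inl (height x).*2; inl (height x).*2.+1; inr s0] => //.
move=> y yx /andP[/some_edgeP[x' [y' [xE yE gxy]]] _].
move: yx xE; rewrite -yE Ex => yx /phase_inl[xE xD'].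
(* The witness [x'] may differ from [x], but its height is below that of every leaf, so [front]
   applies to it. *)
have xf' : x' \notin codom f.
  apply/negP => /codomP[a xa]; move: xE; rewrite xa /height (fold_branch sub).
  by have := fold_nonbranch eC Lgt0 cardV sub xf; have := leaf_ge L a; lia.
move: yx; rewrite /phase; case: ifP => yD; last first.
  by rewrite (front x' y') ?yD // !inE eqxx !orbT.
have injl : injective (@inl nat T) by move=> ? ? [].
rewrite !inE !(inj_eq injl) orbF.
have := fold_adj eC Lgt0 cardV sub gxy; rewrite -/height -/(height x') -/(height y') xE.
by rewrite /heap_near; lia.
Qed.

Lemma phase_dseq_full (D : {set T}) : (forall x, x \in D) ->
  quotient_dseq black red 4 (phase D).
Proof.
move=> full; apply: (@eq_quotient_dseq _ _ _ _ _ (inl \o height)).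
  by move=> x; rewrite /phase full.
apply: (quotient_dseq_heap blackC redC (N := 2 ^ L.+1)).
- by move=> ? ? [].
- exact: fold_ge1.
- by move=> x; apply/ltnW/(fold_lt eC Lgt0 cardV sub).
- exact: (fold_adj eC Lgt0 cardV sub).
Qed.

(** The outer induction folds whole paths: [D] contains each path entirely or not at all. The inner
    one folds a single path from one end to the other. *)
Lemma phase_dseq_closed n (D : {set T}) : #|~: D| <= n -> {subset codom f <= D} ->
  (forall a b x, e a b -> x \in p a b -> x \in D -> {subset p a b <= D}) ->
  quotient_dseq black red 4 (phase D).
Proof.
elim: n D => [|n IH] D Dn fD closed.
  apply: phase_dseq_full => x; move: Dn.
  by rewrite leqn0 cards_eq0 => /eqP/setP/(_ x); rewrite !inE => /negbFE.
case: (pickP [pred x | x \notin D]) => [x /= xD|full]; last first.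
  by apply: phase_dseq_full => x; apply: negbFE (full x).
have xf : x \notin codom f by apply: contra xD => /fD.
have [a [b [ab xab]]] := nonbranch_path sub xf.
have pD y : y \in p a b -> y \notin D.
  by move=> yab; apply: contra xD => yD; apply: closed ab yab yD x xab.
(* [s1] is the prefix already folded, [s2] what remains of the path. *)
suff fill s1 s2 : p a b = s1 ++ s2 ->
    quotient_dseq black red 4 (phase (D :|: [set y in s1])).
  by have := fill [::] (p a b) erefl; apply: eq_quotient_dseq => y;
     rewrite /phase !inE orbF.
elim: s2 s1 => [|s s2 IHs] s1 pE.
  rewrite cats0 in pE; rewrite -pE; apply: IH.
  - rewrite -ltnS; apply: leq_trans Dn; apply: proper_card; apply/properP; split.
      by rewrite setCS subsetUl.
    by exists x; rewrite !inE ?xab ?orbT.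
  - by move=> y /fD yD; rewrite inE yD.
  move=> c d y cd ycd; rewrite !inE => /orP[yD|yab] z zcd; rewrite !inE.
    by rewrite (closed _ _ _ cd ycd yD).
  move: zcd; case: (path_endpoints sub ab cd yab ycd) => -[-> ->] zcd.
    by rewrite zcd orbT.
  by move: zcd; rewrite (path_rev sub ab) mem_rev => ->; rewrite orbT.
apply: (quotient_dseq_step blackC redC (k := inr s) (l := inl (height s))).
  apply: (phase_red_bounded (s0 := s)) => [y /fD yD|y z]; first by rewrite inE yD.
  rewrite !inE negb_or => yDs yf /andP[zD zs1] gyz.
  have zf : z \notin codom f by apply: contra zD => /fD.
  have [c [d [cd ycd zcd]]] := nonbranch_adj sub gyz yf zf.
  (* A path already in [D] has no unfolded vertex, so the edge leaves the prefix [s1]. *)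
  case/orP: yDs => [yD|ys1]; first by rewrite (closed _ _ _ cd ycd yD) in zD.
  have yab : y \in p a b by rewrite pE mem_cat ys1.
  have zab : z \in p a b.
    case: (path_endpoints sub ab cd yab ycd) zcd => -[-> ->] //.
    by rewrite (path_rev sub ab) mem_rev.
  apply: (path_frontier sub ab pE ys1 _ gyz).
  by move: zab; rewrite pE mem_cat (negPf zs1).
have := IHs (rcons s1 s); rewrite cat_rcons => /(_ pE); apply: eq_quotient_dseq => y.
have sab : s \in p a b by rewrite pE mem_cat inE eqxx orbT.
have ss1 : s \notin s1.
  by have := path_uniq sub ab; rewrite pE cat_uniq => /and3P[_ /norP[]].
rewrite /relabel /phase !inE mem_rcons inE.
case: (eqVneq y s) => [->|ys]; first by rewrite orbT (negPf ss1) (negPf (pD _ sab)) eqxx.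
case: ifP => //= _; have -> // : (inr y == inr s :> nat + T) = false.
by apply/eqP => -[] /eqP; rewrite (negPf ys).
Qed.

End Sequence.

Theorem theorem3p1 (V T : finType) (e : rel V) (f : V -> T)
    (p : V -> V -> seq T) (black red : rel T) :
  symmetric e -> irreflexive e ->
  wf_trigraph (Trigraph [set: T] black red) ->
  subdivision_of e (2 * up_log 2 #|V| - 1) (fun x y => black x y || red x y) f p ->
  (forall x, red_degree (Trigraph [set: T] black red) x <= 4) ->
  (forall x y, red_degree (Trigraph [set: T] black red) x = 4 -> ~~ black x y) ->
  tww_le (Trigraph [set: T] black red) 4.
Proof.
move=> eC eI [/= blackC redC _ _ disj] sub deg4 deg4_no_black; exists 4; split=> //.
(* With at most one branch vertex the logarithm is [0] and no tree is available, but [e] is then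
   empty and [T] has at most one vertex. *)
case: (leqP #|V| 1) => [V1|V1].
  apply: dseq_end => //=; apply/card_le1_eqP => x y _ _.
  have codomT z : z \in codom f.
    case: (boolP (z \in codom f)) => // /(nonbranch_path sub)[a [b [ab _]]].
    by rewrite ((card_le1_eqP V1) a b isT isT) eI in ab.
  have [/codomP[a ->] /codomP[b ->]] := (codomT x, codomT y).
  by congr f; apply: (card_le1_eqP V1).
have Lgt0 : 0 < up_log 2 #|V| by rewrite up_log_gt0.
have cardV : #|V| <= 2 ^ up_log 2 #|V| by apply: up_logP.
(* Initially only branch vertices are placed, on distinct leaves, so [phase D] is injective and
   represents the given trigraph. *)
pose D := [set x in codom f].
have disjD a b x : e a b -> x \in p a b -> x \notin D.
  by move=> ab /(path_nonbranch sub ab); rewrite inE.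
apply: (phase_dseq_closed eC blackC redC Lgt0 cardV sub deg4 deg4_no_black (leqnn _) (D := D)).
- by move=> x xf; rewrite inE.
- by move=> a b x ab xab; rewrite (negPf (disjD _ _ _ ab xab)).
apply: represents_injective disj => x y; rewrite /phase.
case: ifP => xD; case: ifP => yD // [] //; move: xD yD.
rewrite !inE => /codomP[a ->] /codomP[b ->].
by rewrite !(fold_branch sub) => /leaf_inj ->.
Qed.
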